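(* Let $\Gamma$ be a group and let $H$ be a normal subgroup of $\Gamma$ of prime index. If the Bockstein $\beta_{\Gamma/H} \in H^2(\Gamma,\mathbb{Z})$ is nilpotent in the cohomology ring $H^*(\Gamma,\mathbb{Z})$, then Moore's conjecture holds for $(\Gamma,H)$ (in particular, Moore's condition holds for $(\Gamma,H)$).
   Context: Let $\Gamma$ be a group and $H$ a subgroup of finite index. The pair $(\Gamma,H)$ satisfies Moore's condition if $\Gamma - H$ (set-theoretic complement) contains no element of prime order. Moore's conjecture holds for $(\Gamma,H)$ (equivalently, $(\Gamma,H)$ satisfies Moore's conjecture) if (a) $(\Gamma,H)$ satisfies Moore's condition, and (b) every $\mathbb{Z}\Gamma$-module which is projective over $\mathbb{Z}H$ is also projective over $\mathbb{Z}\Gamma$. Bockstein: if $H$ is normal in $\Gamma$ of prime index $p$, let $\widehat{\beta}\in H^2(\Gamma/H,\mathbb{Z})$ (trivial coefficients) be the class of the non-split extension $1\to\mathbb{Z}\to\mathbb{Z}\to\Gamma/H\cong\mathbb{Z}_p\to 1$, where $\mathbb{Z}_p$ is the cyclic group of order $p$. The Bockstein of $(\Gamma,H)$ is $\beta_{\Gamma/H}=\inf_{\Gamma/H}^{\Gamma}(\widehat{\beta})\in H^2(\Gamma,\mathbb{Z})$, where $\inf$ is inflation. *)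

(* Defs.v *)
From HB Require Import structures.
From mathcomp Require Import all_boot all_order all_algebra.
From mathcomp Require Import boolp classical_sets functions cardinality.
From mathcomp Require Import finmap monalg.
From mathcomp Require Import ring.

Set Implicit Arguments.
Unset Strict Implicit.
Unset Printing Implicit Defensive.

Import GRing.Theory.

Local Open Scope fset_scope.
Local Open Scope ring_scope.
Local Open Scope quotient_scope.

(* Arbitrary groups are mathcomp's [groupType]s, and a subgroup is a predicate
   H : groupClosed G.  Every type is a choiceType under the classical axioms
   of [boolp], so neither restricts generality. *)

Definition subgroup_type (G : groupType) (H : groupClosed G) : Type :=
  {x : G | x \in H}.

Section SubgroupType.
Variables (G : groupType) (H : groupClosed G).

HB.instance Definition _ := SubChoice.on (subgroup_type H).

Fact subgroup_group_closed : group_closed (fun x : G => x \in H).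
Proof. by split; [exact: gpred1 | move=> x y; exact: gpredF]. Qed.

HB.instance Definition _ :=
  SubChoice_isSubGroup.Build G _ (subgroup_type H) subgroup_group_closed.

Definition subgroup_incl (x : subgroup_type H) : G := val x.

Fact subgroup_incl_morph : {morph subgroup_incl : x y / (x * y)%g}.
Proof. by move=> x y; rewrite /subgroup_incl valM. Qed.

HB.instance Definition _ :=
  monoid.isMultiplicative.Build _ _ subgroup_incl subgroup_incl_morph.

Definition normal_subgroup : Prop := forall x y : G, x \in H -> (x ^ y)%g \in H.

Definition coset_rel (x y : G) : bool := (x^-1 * y)%g \in H.

Fact coset_rel_refl : reflexive coset_rel.
Proof. by move=> x; rewrite /coset_rel mulVg gpred1. Qed.

Fact coset_rel_sym : symmetric coset_rel.
Proof. by move=> x y; rewrite /coset_rel -gpredV invgM invgK. Qed.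

Fact coset_rel_trans : transitive coset_rel.
Proof.
move=> y x z; rewrite /coset_rel => xy yz.
have -> : (x^-1 * z = (x^-1 * y) * (y^-1 * z))%g by rewrite mulgA mulgK.
exact: gpredM.
Qed.

Canonical coset_equiv := EquivRel coset_rel
  coset_rel_refl coset_rel_sym coset_rel_trans.

Definition coset := {eq_quot coset_equiv}.

HB.instance Definition _ := EqQuotient.on coset.
HB.instance Definition _ := Choice.on coset.
End SubgroupType.

Definition quotient_group (G : groupType) (H : groupClosed G)
  (nH : normal_subgroup H) : Type := coset H.

Section QuotientGroup.
Variables (G : groupType) (H : groupClosed G) (nH : normal_subgroup H).

HB.instance Definition _ := Choice.on (quotient_group nH).

Definition quotient_proj (x : G) : quotient_group nH := \pi_(coset H) x.

Definition quotient_mul (a b : quotient_group nH) : quotient_group nH :=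
  quotient_proj (repr (a : coset H) * repr (b : coset H))%g.
Definition quotient_one : quotient_group nH := quotient_proj 1%g.
Definition quotient_inv (a : quotient_group nH) : quotient_group nH :=
  quotient_proj (repr (a : coset H))^-1%g.

Fact quotient_projP (x y : G) :
  quotient_proj x = quotient_proj y <-> (x^-1 * y)%g \in H.
Proof. by split=> [/eqP|h]; [|apply/eqP]; rewrite eqmodE. Qed.

Fact quotient_projK (x : G) : ((repr (quotient_proj x : coset H))^-1 * x)%g \in H.
Proof. by apply/quotient_projP; rewrite /quotient_proj reprK. Qed.

Fact quotient_proj_repr (a : quotient_group nH) :
  quotient_proj (repr (a : coset H)) = a.
Proof. exact: reprK. Qed.

Fact quotient_proj_ind (P : quotient_group nH -> Prop) :
  (forall x, P (quotient_proj x)) -> forall a, P a.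
Proof. by move=> Px a; rewrite -(quotient_proj_repr a). Qed.

Fact quotient_projM (x y : G) :
  quotient_proj (x * y)%g = quotient_mul (quotient_proj x) (quotient_proj y).
Proof.
apply/esym/quotient_projP.
set x' := repr _; set y' := repr _; have hx := quotient_projK x.
have hy := quotient_projK y; rewrite -/x' in hx; rewrite -/y' in hy.
have -> : ((x' * y')^-1 * (x * y) = (x'^-1 * x) ^ y' * (y'^-1 * y))%g.
  by rewrite /conjg invgM !mulgA mulgK.
by apply: gpredM => //; apply: nH.
Qed.

Fact quotient_projV (x : G) :
  quotient_proj x^-1%g = quotient_inv (quotient_proj x).
Proof.
apply/quotient_projP; set x' := repr _.
have hx : (x'^-1 * x)%g \in H by exact: quotient_projK.
have -> : ((x^-1)^-1 * x'^-1 = (x'^-1 * x) ^ x'^-1)%g.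
  by rewrite /conjg !invgK !mulgA mulgV mul1g.
exact: nH.
Qed.

Fact quotient_mulA : associative quotient_mul.
Proof.
elim/quotient_proj_ind=> x; elim/quotient_proj_ind=> y.
by elim/quotient_proj_ind=> z; rewrite -!quotient_projM mulgA.
Qed.

Fact quotient_mul1g : left_id quotient_one quotient_mul.
Proof. by elim/quotient_proj_ind=> x; rewrite -quotient_projM mul1g. Qed.

Fact quotient_mulg1 : right_id quotient_one quotient_mul.
Proof. by elim/quotient_proj_ind=> x; rewrite -quotient_projM mulg1. Qed.

Fact quotient_mulVg : left_inverse quotient_one quotient_inv quotient_mul.
Proof.
by elim/quotient_proj_ind=> x; rewrite -quotient_projV -quotient_projM mulVg.
Qed.

Fact quotient_mulgV : right_inverse quotient_one quotient_inv quotient_mul.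
Proof.
by elim/quotient_proj_ind=> x; rewrite -quotient_projV -quotient_projM mulgV.
Qed.

HB.instance Definition _ := monoid.isGroup.Build (quotient_group nH)
  quotient_mulA quotient_mul1g quotient_mulg1 quotient_mulVg quotient_mulgV.

HB.instance Definition _ :=
  monoid.isMultiplicative.Build G (quotient_group nH) quotient_proj
    quotient_projM.
End QuotientGroup.

Fact group_morph1 (G Q : groupType) (f : {multiplicative G -> Q}) :
  f 1%g = 1%g.
Proof. by apply: (@mulgI _ (f 1%g)); rewrite -gmulfM !mulg1. Qed.

(* The integral group ring Z[G].  The library's own product on {malg int[K]}
   requires K to have no nontrivial units, so the convolution product is put
   here on the underlying free abelian group. *)
Definition group_ring (G : groupType) : Type := {malg int[G]}.

Section GroupRing.
Variable G : groupType.
Implicit Types (x y : group_ring G) (g h : G) (c : int).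

HB.instance Definition _ := GRing.Zmodule.on (group_ring G).

Definition gring_one : group_ring G := << 1%g >>.

Definition gring_mul x y : group_ring G :=
  \sum_(g <- msupp x) \sum_(h <- msupp y) << x@_g * y@_h *g (g * h)%g >>.

Fact gring_mulw (d e : {fset G}) x y : msupp x `<=` d -> msupp y `<=` e ->
  gring_mul x y = \sum_(g <- d) \sum_(h <- e) << x@_g * y@_h *g (g * h)%g >>.
Proof.
move=> xd ye; rewrite /gring_mul (big_fset_incl _ xd) /=.
  apply/eq_bigr => g _; apply/big_fset_incl => // h _ /mcoeff_outdom ->.
  by rewrite mulr0 monalgU0.
move=> g _ /mcoeff_outdom xg.
by rewrite big1 // => h _; rewrite xg mul0r monalgU0.
Qed.

Fact gring_mulDl : left_distributive gring_mul +%R.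
Proof.
move=> x x' y; have sub1 := fsubsetUl (msupp x) (msupp x').
have sub2 := fsubsetUr (msupp x) (msupp x').
rewrite (gring_mulw sub1 (fsubset_refl _)) (gring_mulw sub2 (fsubset_refl _)).
rewrite (gring_mulw (msuppD_le x x') (fsubset_refl _)).
rewrite -big_split /=; apply/eq_bigr=> g _.
rewrite -big_split /=; apply/eq_bigr=> h _.
by rewrite mcoeffD mulrDl monalgUD.
Qed.

Fact gring_mulDr : right_distributive gring_mul +%R.
Proof.
move=> y x x'; have sub1 := fsubsetUl (msupp x) (msupp x').
have sub2 := fsubsetUr (msupp x) (msupp x').
rewrite (gring_mulw (fsubset_refl _) sub1) (gring_mulw (fsubset_refl _) sub2).
rewrite (gring_mulw (fsubset_refl _) (msuppD_le x x')).
rewrite -big_split /=; apply/eq_bigr=> g _.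
rewrite -big_split /=; apply/eq_bigr=> h _.
by rewrite mcoeffD mulrDr monalgUD.
Qed.

Fact gring_mul0l y : gring_mul 0 y = 0.
Proof. by rewrite /gring_mul msupp0 big_seq_fset0. Qed.

Fact gring_mul0r x : gring_mul x 0 = 0.
Proof. by rewrite /gring_mul big1 // => g _; rewrite msupp0 big_seq_fset0. Qed.

Fact gring_mulUU c c' g h :
  gring_mul << c *g g >> << c' *g h >> = << c * c' *g (g * h)%g >>.
Proof.
by rewrite (gring_mulw msuppU_le msuppU_le) !big_seq_fset1 !mcoeffUU.
Qed.

Fact gring_ind (P : group_ring G -> Prop) : P 0 ->
  (forall x y, P x -> P y -> P (x + y)) -> (forall c g, P << c *g g >>) ->
  forall x, P x.
Proof.
by move=> P0 PD PU x; rewrite [x]monalgE; apply: (big_ind P) => // g _; apply: PU.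
Qed.

Fact gring_mulA : associative gring_mul.
Proof.
move=> x y z; elim/gring_ind: x => [|x x' ihx ihx'|c g].
- by rewrite !gring_mul0l.
- by rewrite !gring_mulDl ihx ihx'.
elim/gring_ind: y => [|y y' ihy ihy'|c' g'].
- by rewrite !(gring_mul0l, gring_mul0r).
- by rewrite !(gring_mulDl, gring_mulDr) ihy ihy'.
elim/gring_ind: z => [|z z' ihz ihz'|c'' g''].
- by rewrite !gring_mul0r.
- by rewrite !gring_mulDr ihz ihz'.
by rewrite !gring_mulUU mulrA mulgA.
Qed.

Fact gring_mul1l : left_id gring_one gring_mul.
Proof.
elim/gring_ind=> [|x y ihx ihy|c g]; first exact: gring_mul0r.
- by rewrite gring_mulDr ihx ihy.
- by rewrite gring_mulUU mul1r mul1g.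
Qed.

Fact gring_mul1r : right_id gring_one gring_mul.
Proof.
elim/gring_ind=> [|x y ihx ihy|c g]; first exact: gring_mul0l.
- by rewrite gring_mulDl ihx ihy.
- by rewrite gring_mulUU mulr1 mulg1.
Qed.

Fact gring_one_neq0 : gring_one != 0.
Proof. by rewrite monalgU_eq0. Qed.

HB.instance Definition _ := GRing.Zmodule_isNzRing.Build (group_ring G)
  gring_mulA gring_mul1l gring_mul1r gring_mulDl gring_mulDr gring_one_neq0.
End GroupRing.

Section GroupRingMap.
Variables (G Q : groupType) (f : {multiplicative G -> Q}).

Definition gring_map (x : group_ring G) : group_ring Q :=
  \sum_(g <- msupp x) << x@_g *g f g >>.

Fact gring_mapw (d : {fset G}) (x : group_ring G) : msupp x `<=` d ->
  gring_map x = \sum_(g <- d) << x@_g *g f g >>.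
Proof.
move=> xd; rewrite /gring_map (big_fset_incl _ xd) //= => g _ /mcoeff_outdom ->.
by rewrite monalgU0.
Qed.

Fact gring_map_semi_additive : nmod_morphism gring_map.
Proof.
split=> [|x y]; first by rewrite /gring_map msupp0 big_seq_fset0.
rewrite (gring_mapw (msuppD_le x y)) (gring_mapw (fsubsetUl _ (msupp y))).
rewrite (gring_mapw (fsubsetUr (msupp x) _)) -big_split /=.
by apply/eq_bigr => g _; rewrite mcoeffD monalgUD.
Qed.

HB.instance Definition _ := GRing.isNmodMorphism.Build _ _ gring_map
  gring_map_semi_additive.

Fact gring_mapU (c : int) (g : G) : gring_map << c *g g >> = << c *g f g >>.
Proof. by rewrite (gring_mapw msuppU_le) big_seq_fset1 mcoeffUU. Qed.

Fact gring_map_monoid_morphism : monoid_morphism gring_map.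
Proof.
split=> [|x y]; first by rewrite gring_mapU group_morph1.
elim/gring_ind: x => [|x x' ihx ihx'|c g].
- by rewrite mul0r raddf0 mul0r.
- by rewrite mulrDl !raddfD /= ihx ihx' mulrDl.
elim/gring_ind: y => [|y y' ihy ihy'|c' g'].
- by rewrite mulr0 raddf0 mulr0.
- by rewrite mulrDr !raddfD /= ihy ihy' mulrDr.
by rewrite !gring_mapU [LHS](congr1 _ (gring_mulUU _ _ _ _)) gring_mapU gmulfM
  -gring_mulUU.
Qed.

HB.instance Definition _ := GRing.isMonoidMorphism.Build _ _ gring_map
  gring_map_monoid_morphism.
End GroupRingMap.

(* M viewed as an S-module along phi. *)
Definition restrict_scalars (S R : nzRingType) (phi : {rmorphism S -> R})
  (M : lmodType R) : Type := M.

Section RestrictScalars.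
Variables (S R : nzRingType) (phi : {rmorphism S -> R}) (M : lmodType R).

HB.instance Definition _ := GRing.Zmodule.on (restrict_scalars phi M).

Definition rs_scale (s : S) (m : restrict_scalars phi M) :
  restrict_scalars phi M := phi s *: (m : M).

Fact rs_scaleA s t m : rs_scale s (rs_scale t m) = rs_scale (s * t) m.
Proof. by rewrite /rs_scale scalerA rmorphM. Qed.
Fact rs_scale1 : left_id 1 rs_scale.
Proof. by move=> m; rewrite /rs_scale rmorph1 scale1r. Qed.
Fact rs_scaleDr : right_distributive rs_scale +%R.
Proof. by move=> s m n; exact: scalerDr. Qed.
Fact rs_scaleDl m : {morph rs_scale^~ m : s t / s + t}.
Proof. by move=> s t; rewrite /rs_scale rmorphD; exact: scalerDl. Qed.

HB.instance Definition _ := GRing.Zmodule_isLmodule.Build S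
  (restrict_scalars phi M) rs_scaleA rs_scale1 rs_scaleDr rs_scaleDl.
End RestrictScalars.

Definition projective (R : nzRingType) (P : lmodType R) : Prop :=
  forall (M N : lmodType R) (g : {linear M -> N}) (f : {linear P -> N}),
    (forall n, exists m, g m = n) ->
    exists h : {linear P -> M}, forall x, g (h x) = f x.

Definition has_order (G : groupType) (x : G) (n : nat) : Prop :=
  [/\ (0 < n)%N, (x ^+ n = 1)%g &
      forall m, (0 < m < n)%N -> (x ^+ m <> 1)%g].

Definition Moore_condition (G : groupType) (H : groupClosed G) : Prop :=
  forall x : G, x \notin H -> forall q : nat, prime q -> ~ has_order x q.

(* Used only for H of finite index in G. *)
Definition Moore_conjecture (G : groupType) (H : groupClosed G) : Prop :=
  Moore_condition H /\
  forall M : lmodType (group_ring G),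
    projective (restrict_scalars (gring_map (@subgroup_incl G H)) M) ->
    projective M.

(* Group cohomology with trivial integer coefficients, computed by inhomogeneous
   bar cochains.  A single function on lists packages cochains of all degrees:
   its degree-n component is its restriction to lists of length n, and the
   cochain complex consists of those of bounded degree (direct sum, not
   product). *)
Definition cochain (G : groupType) : Type := seq G -> int.

Section Cochains.
Variable G : groupType.
Implicit Types (f g h : cochain G) (s t : seq G).

HB.instance Definition _ := Choice.copy (cochain G) (forall _ : seq G, int).

Definition bounded_degree f : Prop :=
  exists N : nat, forall s, (N <= size s)%N -> f s = 0.

(* face i [x_1, ..., x_n], for 0 <= i <= n, drops x_1 (i = 0), drops x_n
   (i = n), and otherwise merges x_i and x_(i+1) into their product. *)
Fixpoint face (i : nat) s {struct i} : seq G :=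
  match i, s with
  | 0, _ => behead s
  | 1, [:: x, y & t] => (x * y)%g :: t
  | j.+1, x :: ((_ :: _) as t) => x :: face j t
  | _, _ => [::]
  end.

Definition coboundary f : cochain G := fun s =>
  if s is [::] then 0 else \sum_(i < (size s).+1) (-1) ^+ i * f (face i s).

(* Some authors insert a sign (-1)^(mn) in degrees m, n; on a homogeneous
   class this changes the powers only up to sign. *)
Definition cup f g : cochain G := fun s =>
  \sum_(i < (size s).+1) f (take i s) * g (drop i s).

Definition cochain_zero : cochain G := fun=> 0.
Definition cochain_opp f : cochain G := fun s => - f s.
Definition cochain_add f g : cochain G := fun s => f s + g s.
Definition cochain_one : cochain G := fun s => (s == [::])%:R.

Definition cshift (x : G) f : cochain G := fun s => f (x :: s).

Fact cup_nil f g : cup f g [::] = f [::] * g [::].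
Proof. by rewrite /cup big_ord1. Qed.

Fact cup_cons f g x s :
  cup f g (x :: s) = f [::] * g (x :: s) + cup (cshift x f) g s.
Proof. by rewrite /cup big_ord_recl. Qed.

Fact cup_linl a b f f' g s :
  cup (fun t => a * f t + b * f' t) g s = a * cup f g s + b * cup f' g s.
Proof.
rewrite /cup !mulr_sumr -big_split; apply: eq_bigr => i _ /=.
by rewrite mulrDl !mulrA.
Qed.

Fact cup_linr a b f g g' s :
  cup f (fun t => a * g t + b * g' t) s = a * cup f g s + b * cup f g' s.
Proof.
rewrite /cup !mulr_sumr -big_split; apply: eq_bigr => i _ /=.
by ring.
Qed.

Fact eq_cup f f' g g' s : f =1 f' -> g =1 g' -> cup f g s = cup f' g' s.
Proof. by move=> ff gg; apply: eq_bigr => i _; rewrite ff gg. Qed.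

Fact cupA : associative cup.
Proof.
move=> f g h; apply/funext => s; elim: s f => [|x s IHs] f.
  by rewrite !cup_nil mulrA.
rewrite cup_cons (cup_cons (cup f g)) cup_nil IHs cup_cons.
have -> : cup (cshift x (cup f g)) h s =
    f [::] * cup (cshift x g) h s + 1 * cup (cup (cshift x f) g) h s.
  by rewrite -cup_linl; apply: eq_cup => // t; rewrite mul1r /cshift cup_cons.
by rewrite mulrDr mulrA mul1r addrA.
Qed.

Fact cup_addl : left_distributive cup cochain_add.
Proof.
move=> f f' g; apply/funext => s; rewrite /cochain_add.
rewrite -[cup f g s]mul1r -[cup f' g s]mul1r -cup_linl.
by apply: eq_cup => // t; rewrite !mul1r.
Qed.

Fact cup_addr : right_distributive cup cochain_add.
Proof.
move=> f g g'; apply/funext => s; rewrite /cochain_add.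
rewrite -[cup f g s]mul1r -[cup f g' s]mul1r -cup_linr.
by apply: eq_cup => // t; rewrite !mul1r.
Qed.

Fact cup1l : left_id cochain_one cup.
Proof.
move=> f; apply/funext => -[|x s]; first by rewrite cup_nil mul1r.
rewrite cup_cons mul1r [X in _ + X]big1 ?addr0 // => i _.
by rewrite /cshift /cochain_one mul0r.
Qed.

Fact cup1r : right_id cochain_one cup.
Proof.
move=> f; apply/funext => s; elim: s f => [|x s IHs] f.
  by rewrite cup_nil mulr1.
by rewrite cup_cons IHs mulr0 add0r.
Qed.

Fact cochain_addA : associative cochain_add.
Proof. by move=> f g h; apply/funext => s; exact: addrA. Qed.
Fact cochain_addC : commutative cochain_add.
Proof. by move=> f g; apply/funext => s; exact: addrC. Qed.
Fact cochain_add0 : left_id cochain_zero cochain_add.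
Proof. by move=> f; apply/funext => s; exact: add0r. Qed.
Fact cochain_addN : left_inverse cochain_zero cochain_opp cochain_add.
Proof. by move=> f; apply/funext => s; exact: addNr. Qed.

HB.instance Definition _ := GRing.isZmodule.Build (cochain G)
  cochain_addA cochain_addC cochain_add0 cochain_addN.
Fact cochain_one_neq0 : cochain_one != 0 :> cochain G.
Proof. by apply/eqP => /(congr1 (fun f : cochain G => f [::])). Qed.

HB.instance Definition _ := GRing.Zmodule_isNzRing.Build (cochain G)
  cupA cup1l cup1r cup_addl cup_addr cochain_one_neq0.

Fact cochainD f g s : (f + g) s = f s + g s. Proof. by []. Qed.
Fact cochainN f s : (- f) s = - f s. Proof. by []. Qed.
Fact cochain0 s : (0 : cochain G) s = 0. Proof. by []. Qed.
Fact cochain1 s : (1 : cochain G) s = (s == [::])%:R. Proof. by []. Qed.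
Fact cochainM f g s : (f * g) s = cup f g s. Proof. by []. Qed.
Definition cochainE := (cochainD, cochainN, cochain0, cochain1, cochainM).

Fact size_face i x s : (i < (size (x :: s)).+1)%N -> size (face i (x :: s)) = size s.
Proof. by elim: i x s => [|[|i] IHi] x [|y s] // lti; rewrite /= IHi. Qed.

Fact coboundary_nil f : coboundary f [::] = 0. Proof. by []. Qed.

Fact coboundary1 f x : coboundary f [:: x] = 0.
Proof. by rewrite /coboundary !big_ord_recl big_ord0 /= expr0 expr1; ring. Qed.

Fact face_cons i x y s :
  face i.+2 [:: x, y & s] = x :: face i.+1 (y :: s).
Proof. by []. Qed.

Fact coboundary_cons f x y s : coboundary f [:: x, y & s] =
  f (y :: s) - f ((x * y)%g :: s) + f (x :: s)
  - coboundary (cshift x f) (y :: s).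
Proof.
rewrite /coboundary; do 2!rewrite big_ord_recl; rewrite [in RHS]big_ord_recl.
rewrite (eq_bigr (fun i : 'I_(size (y :: s)) =>
  - ((-1) ^+ lift ord0 i * cshift x f (face (lift ord0 i) (y :: s))))).
  by rewrite sumrN !lift0 /cshift /= expr0 expr1; ring.
by move=> i _; rewrite !lift0 face_cons /cshift [in LHS]exprS; ring.
Qed.

Fact coboundary_lin a b f g s :
  coboundary (fun t => a * f t + b * g t) s
    = a * coboundary f s + b * coboundary g s.
Proof.
case: s => [|x s]; first by rewrite !mulr0 addr0.
rewrite /coboundary !mulr_sumr -big_split; apply: eq_bigr => i _ /=.
by ring.
Qed.

Fact coboundary_additive : zmod_morphism coboundary.
Proof.
move=> f g; apply/funext => s; rewrite !cochainE.
rewrite -[coboundary f s]mul1r -[- coboundary g s]mulN1r -coboundary_lin.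
by congr (coboundary _ s); apply/funext => t; rewrite mul1r mulN1r.
Qed.

HB.instance Definition _ := GRing.isZmodMorphism.Build _ _ coboundary
  coboundary_additive.

Definition deg_sign f : cochain G := fun s => (-1) ^+ size s * f s.

Fact coboundary_cup f g :
  coboundary (f * g) = coboundary f * g + deg_sign f * coboundary g.
Proof.
apply/funext => s; rewrite !cochainE; elim: s f => [|x [|y s] IHs] f.
- by rewrite !cup_nil !coboundary_nil mul0r mulr0.
- rewrite coboundary1 !cup_cons !cup_nil /cshift !coboundary1 !coboundary_nil.
  by ring.
have shift_prod : coboundary (cshift x (f * g)) (y :: s) =
    f [::] * coboundary (cshift x g) (y :: s)
    + 1 * coboundary (cshift x f * g) (y :: s).
  rewrite -coboundary_lin; congr (coboundary _ _); apply/funext => t.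
  by rewrite /cshift !cochainE cup_cons mul1r.
have shift_d : cshift y (cshift x (coboundary f)) =
    (fun t => 1 * (1 * cshift y f t + (-1) * cshift (x * y)%g f t)
     + 1 * (1 * cshift x f t + (-1) * cshift y (coboundary (cshift x f)) t)).
  by apply/funext => t; rewrite {1}/cshift {1}/cshift coboundary_cons /cshift; ring.
have shift_sign : cshift x (deg_sign f) =
    (fun t => (-1) * deg_sign (cshift x f) t + 0 * deg_sign (cshift x f) t).
  by apply/funext => t; rewrite /cshift /deg_sign /= exprS; ring.
rewrite coboundary_cons !cochainE shift_prod {}IHs.
rewrite (cup_cons (coboundary f)) (cup_cons (cshift x (coboundary f))).
rewrite (cup_cons (coboundary (cshift x f))) (cup_cons (deg_sign f)).
rewrite shift_d shift_sign !cup_linl 3!(cup_cons f) coboundary_cons.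
have -> : cshift x (coboundary f) [::] = 0 by exact: coboundary1.
have -> : deg_sign f [::] = f [::] by rewrite /deg_sign mul1r.
by rewrite !coboundary_nil /cshift; ring.
Qed.

Fact deg_signM f g : deg_sign (f * g) = deg_sign f * deg_sign g.
Proof.
apply/funext => s; rewrite /deg_sign !cochainE /cup mulr_sumr.
apply: eq_bigr => i _; rewrite -{1}[s](cat_take_drop i) size_cat exprD.
by ring.
Qed.

Fact coboundary_sign f :
  coboundary (deg_sign f) = - deg_sign (coboundary f).
Proof.
apply/funext => -[|x s]; first by rewrite cochainE /deg_sign mulr0 oppr0.
rewrite cochainE /deg_sign /coboundary mulr_sumr -sumrN.
apply: eq_bigr => -[i lti] _ /=; rewrite size_face //.
by rewrite exprS; ring.
Qed.

Fact bounded_degree0 : bounded_degree 0. Proof. by exists 0%N. Qed.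
Fact bounded_degree1 : bounded_degree 1.
Proof. by exists 1%N => -[]. Qed.
Fact bounded_degreeB f g :
  bounded_degree f -> bounded_degree g -> bounded_degree (f - g).
Proof.
move=> [m fm] [n gn]; exists (maxn m n) => s; rewrite geq_max => /andP[ms ns].
by rewrite !cochainE fm // gn // subr0.
Qed.
Fact bounded_degreeM f g :
  bounded_degree f -> bounded_degree g -> bounded_degree (f * g).
Proof.
move=> [m fm] [n gn]; exists (m + n)%N => s sizes.
rewrite cochainE /cup big1 // => i _; have [mi|im] := leqP m i.
  rewrite fm ?mul0r // size_take; case: ltnP => // _.
  exact: leq_trans (leq_addr _ _) sizes.
rewrite gn ?mulr0 // size_drop leq_subRL; last by rewrite -ltnS.
by rewrite (leq_trans _ sizes) // leq_add2r ltnW.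
Qed.
Fact bounded_degree_sign f : bounded_degree f -> bounded_degree (deg_sign f).
Proof. by move=> [m fm]; exists m => s ms; rewrite /deg_sign fm ?mulr0. Qed.

Definition cocycle : {pred cochain G} :=
  fun f => `[< bounded_degree f /\ coboundary f = 0 >].

Definition is_coboundary f : Prop :=
  exists2 h, bounded_degree h & f = coboundary h.

Fact cocycleP f : reflect (bounded_degree f /\ coboundary f = 0) (f \in cocycle).
Proof. exact: asboolP. Qed.

Fact cocycle_subring : subring_closed cocycle.
Proof.
split=> [|f g /cocycleP[bf df] /cocycleP[bg dg]|
         f g /cocycleP[bf df] /cocycleP[bg dg]]; apply/cocycleP; split.
- exact: bounded_degree1.
- apply/funext => -[|x [|y s]] //; first by rewrite coboundary1.
  rewrite /coboundary big1 // => -[i lti] _; rewrite cochain1 -size_eq0.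
  by rewrite size_face // mulr0.
- exact: bounded_degreeB.
- by rewrite raddfB /= df dg subr0.
- exact: bounded_degreeM.
- by rewrite coboundary_cup df dg mul0r mulr0 addr0.
Qed.

HB.instance Definition _ := GRing.isSubringClosed.Build (cochain G) cocycle
  cocycle_subring.

Definition cocycle_type := {f : cochain G | f \in cocycle}.
HB.instance Definition _ := SubChoice.on cocycle_type.
HB.instance Definition _ :=
  [SubChoice_isSubNzRing of cocycle_type by <:].

Definition coboundaries : {pred cocycle_type} :=
  fun z => `[< is_coboundary (val z) >].

Fact coboundariesP (z : cocycle_type) :
  reflect (is_coboundary (val z)) (z \in coboundaries).
Proof. exact: asboolP. Qed.

Fact coboundaries_zmod : zmod_closed coboundaries.
Proof.
split=> [|y z /coboundariesP[f bf yE] /coboundariesP[g bg zE]]; apply/coboundariesP.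
  by exists 0; [exact: bounded_degree0 | rewrite !raddf0].
by exists (f - g); [exact: bounded_degreeB | rewrite !raddfB /= yE zE].
Qed.

HB.instance Definition _ := GRing.isZmodClosed.Build cocycle_type coboundaries
  coboundaries_zmod.

Fact coboundariesMl (y z : cocycle_type) :
  z \in coboundaries -> y * z \in coboundaries.
Proof.
case: y => f fP /coboundariesP[g bg zE]; apply/coboundariesP.
have /cocycleP[bf df] := fP.
exists (deg_sign f * g).
  by apply: bounded_degreeM => //; exact: bounded_degree_sign.
rewrite rmorphM /= zE coboundary_cup coboundary_sign df.
have -> : deg_sign 0 = 0 by apply/funext => s; rewrite /deg_sign mulr0.
rewrite oppr0 mul0r add0r; congr (_ * _); apply/funext => s.
by rewrite /deg_sign mulrA -exprMn mulrNN mulr1 expr1n mul1r.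
Qed.

Fact coboundariesMr (y z : cocycle_type) :
  y \in coboundaries -> y * z \in coboundaries.
Proof.
case: z => f fP /coboundariesP[g bg yE]; apply/coboundariesP.
have /cocycleP[bf df] := fP; exists (g * f); first exact: bounded_degreeM.
by rewrite rmorphM /= yE coboundary_cup df mulr0 addr0.
Qed.

End Cochains.

Definition cohomology (G : groupType) : Type := {ideal_quot (@coboundaries G)}.

Section CohomologyRing.
Variable G : groupType.

HB.instance Definition _ := GRing.Zmodule.on (cohomology G).

Definition cohomology_class (z : cocycle_type G) : cohomology G :=
  \pi_{ideal_quot (@coboundaries G)} z.

Definition cocycle_repr (a : cohomology G) : cocycle_type G :=
  repr (a : {ideal_quot (@coboundaries G)}).

Definition cohomology_one : cohomology G := cohomology_class 1.
Definition cohomology_mul (a b : cohomology G) : cohomology G :=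
  cohomology_class (cocycle_repr a * cocycle_repr b).

Fact cohomology_classP (y z : cocycle_type G) :
  cohomology_class y = cohomology_class z <-> is_coboundary (val y - val z).
Proof.
rewrite -raddfB; split=> [/eqP|/coboundariesP h]; last apply/eqP.
  by rewrite -Quotient.idealrBE => /coboundariesP.
by rewrite -Quotient.idealrBE.
Qed.

Fact cocycle_reprK a : cohomology_class (cocycle_repr a) = a.
Proof. exact: reprK. Qed.

Fact cohomology_ind (P : cohomology G -> Prop) :
  (forall z, P (cohomology_class z)) -> forall a, P a.
Proof. by move=> Pz a; rewrite -(cocycle_reprK a). Qed.

Fact cohomology_classB : zmod_morphism cohomology_class.
Proof. by move=> y z; rewrite /cohomology_class !piE. Qed.

HB.instance Definition _ := GRing.isZmodMorphism.Build _ _ cohomology_class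
  cohomology_classB.

Fact cohomology_classM y z : cohomology_class (y * z) =
  cohomology_mul (cohomology_class y) (cohomology_class z).
Proof.
apply/cohomology_classP; rewrite -raddfB; apply/coboundariesP.
set y' := cocycle_repr _; set z' := cocycle_repr _.
have yy' : y - y' \in coboundaries (G := G).
  apply/coboundariesP; rewrite raddfB; apply/cohomology_classP.
  by rewrite cocycle_reprK.
have zz' : z - z' \in coboundaries (G := G).
  apply/coboundariesP; rewrite raddfB; apply/cohomology_classP.
  by rewrite cocycle_reprK.
have -> : y * z - y' * z' = (y - y') * z + y' * (z - z').
  by rewrite mulrBl mulrBr addrA subrK.
by apply: rpredD; [exact: coboundariesMr | exact: coboundariesMl].
Qed.

Fact cohomology_mulA : associative cohomology_mul.
Proof.
elim/cohomology_ind=> x; elim/cohomology_ind=> y; elim/cohomology_ind=> z.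
by rewrite -!cohomology_classM mulrA.
Qed.
Fact cohomology_mul1l : left_id cohomology_one cohomology_mul.
Proof. by elim/cohomology_ind=> x; rewrite /cohomology_one -cohomology_classM mul1r. Qed.
Fact cohomology_mul1r : right_id cohomology_one cohomology_mul.
Proof. by elim/cohomology_ind=> x; rewrite /cohomology_one -cohomology_classM mulr1. Qed.
Fact cohomology_mulDl : left_distributive cohomology_mul +%R.
Proof.
elim/cohomology_ind=> x; elim/cohomology_ind=> y; elim/cohomology_ind=> z.
by rewrite -!cohomology_classM -!raddfD -cohomology_classM mulrDl.
Qed.
Fact cohomology_mulDr : right_distributive cohomology_mul +%R.
Proof.
elim/cohomology_ind=> x; elim/cohomology_ind=> y; elim/cohomology_ind=> z.
by rewrite -!cohomology_classM -!raddfD -cohomology_classM mulrDr.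
Qed.
Fact cohomology_one_neq0 : cohomology_one != 0.
Proof.
rewrite /cohomology_one -(raddf0 cohomology_class); apply/eqP.
move=> /cohomology_classP[h _]; rewrite raddf0 subr0.
by move=> /(congr1 (fun f : cochain G => f [::])).
Qed.

HB.instance Definition _ := GRing.Zmodule_isNzRing.Build (cohomology G)
  cohomology_mulA cohomology_mul1l cohomology_mul1r
  cohomology_mulDl cohomology_mulDr cohomology_one_neq0.

HB.instance Definition _ := GRing.isMonoidMorphism.Build _ _ cohomology_class
  (conj (erefl : cohomology_class 1 = 1) cohomology_classM).
End CohomologyRing.

Section Inflation.
Variables (G Q : groupType) (f : {multiplicative G -> Q}).

Definition cochain_pullback (c : cochain Q) : cochain G := fun s => c (map f s).

Fact face_map i s : map f (face i s) = face i (map f s).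
Proof.
elim: i s => [|[|i] IHi] [|x [|y s]] //=; first by rewrite gmulfM.
by congr (_ :: _); exact: (IHi (y :: s)).
Qed.

Fact pullback_coboundary c :
  coboundary (cochain_pullback c) = cochain_pullback (coboundary c).
Proof.
apply/funext => -[|x s] //; rewrite /cochain_pullback /coboundary /= size_map.
by apply: eq_bigr => i _; rewrite face_map.
Qed.

Fact pullback_bounded c : bounded_degree c -> bounded_degree (cochain_pullback c).
Proof. by move=> [N cN]; exists N => s Ns; apply: cN; rewrite size_map. Qed.

Fact pullback_cocycle (z : cocycle_type Q) : cochain_pullback (val z) \in @cocycle G.
Proof.
have /cocycleP[bc dc] := valP z; apply/cocycleP; split.
  exact: pullback_bounded.
by rewrite pullback_coboundary dc.
Qed.

Definition cocycle_pullback (z : cocycle_type Q) : cocycle_type G :=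
  Sub (cochain_pullback (val z)) (pullback_cocycle z).

Definition inflation (a : cohomology Q) : cohomology G :=
  cohomology_class (cocycle_pullback (cocycle_repr a)).

Fact inflation_class z :
  inflation (cohomology_class z) = cohomology_class (cocycle_pullback z).
Proof.
apply/cohomology_classP => /=.
have [h bh eh] := (cohomology_classP _ _).1 (cocycle_reprK (cohomology_class z)).
exists (cochain_pullback h); first exact: pullback_bounded.
by rewrite pullback_coboundary -eh.
Qed.
End Inflation.

(* Exactness of 1 -> Z -> Z -> Q -> 1, with maps i and q. *)
Definition ZZ_extension (Q : groupType) (i : int -> int) (q : int -> Q) : Prop :=
  [/\ {morph i : m n / m + n}, injective i,
      {morph q : m n / m + n >-> (m * n)%g}, (forall a, exists n, q n = a) &
      forall n, q n = 1%g <-> exists m, i m = n].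

(* The class of the extension is that of the 2-cocycle (a, b) |->
   sigma(a) sigma(b) sigma(ab)^-1, for a set-theoretic section sigma of q. *)
Definition ZZ_extension_class (Q : groupType) (i : int -> int) (q : int -> Q)
    (e : cohomology Q) : Prop :=
  exists (sigma : Q -> int) (z : cocycle_type Q),
    [/\ cancel sigma q,
        forall a b, i (val z [:: a; b]) = sigma a + sigma b - sigma (a * b)%g,
        forall s, size s <> 2 -> val z s = 0 &
        e = cohomology_class z].

(* The class beta_hat depends on the identification of G / H with Z/p (and on
   the sign of i), so there are p - 1 possible Bocksteins, which are multiples
   of one another by units of Z/p; is_bockstein holds of each of them. *)
Definition is_bockstein (G : groupType) (H : groupClosed G)
    (nH : normal_subgroup H) (beta : cohomology G) : Prop :=
  exists (i : int -> int) (q : int -> quotient_group nH)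
         (beta_hat : cohomology (quotient_group nH)),
    [/\ ZZ_extension i q, ZZ_extension_class i q beta_hat &
        beta = inflation (@quotient_proj G H nH) beta_hat].

Definition nilpotent_element (R : nzRingType) (x : R) : Prop :=
  exists n : nat, x ^+ n = 0.

(* Main.v *)
Require Import Defs.
From HB Require Import structures.
From mathcomp Require Import all_boot all_order all_algebra.
From mathcomp Require Import boolp classical_sets functions cardinality.
From mathcomp Require Import finmap monalg.
From mathcomp Require Import zify ring lra.

(** Let z be the 2-cocycle on the group G that represents the Bockstein, and
    let t be an element of G with t ^+ r in H.

    Both halves of Moore's conjecture come out of one descent.  View z as a
    homogeneous cochain, invariant under translation by G.  Among cochains
    that are invariant only under H it is a coboundary, z = d u, because its
    restriction to H is trivial; u is not invariant under t, but
    (t - 1) u = d v for a 0-cochain v with values in Z, and the sum N v of the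
    r translates of v by the powers of t is a constant m.  So z is encoded by
    the zigzag z, u, v, m: this is the periodicity of the cohomology of a
    cyclic group, made explicit.

    Now let E be a class of cochains with values in some coefficients A, stable
    under t, killed by t ^+ r - 1, and in which every cocycle is a coboundary,
    and let e in A be fixed by t.  Suppose that z ^+ (n+1) e = d h with h in E
    fixed by t, and put w = z ^+ n.  Then u w e - h is a cocycle of E, hence
    d y; then v w e - (t - 1) y is a cocycle too, hence d y'; and applying N
    gives m w e = d (N y') (lemma descent_step).  After n+1 steps the power of
    z is used up, and in degree -1 of the augmented complex one reads
    m ^+ (n+1) e = N a for some value a of a cochain of E (theorem descent).

    Projectivity.  Take A = End(M), e = id, and for E the H-equivariant
    cochains.  They have no cohomology because M is projective over Z[H]: such
    a module carries an averaging operator (projective_averaging), which gives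
    a contracting homotopy (equivariant_cochain_acyclic).  Choosing t over a
    generator of G / H, v can be normalized so that m is 1 or -1, and the
    descent writes id as the transfer, up to sign, of an H-linear endomorphism
    phi of M.  By the argument of D. Higman this makes M projective over Z[G]:
    precompose a lifting over Z[H] with phi and take its transfer
    (transfer_projective).

    Moore's condition.  If x outside H has prime order, this order is the index
    p.  Take t = x, A = Z with trivial action, e = 1, and for E all cochains, on
    which d is exact.  The transfer on Z is multiplication by p, and m is, up
    to sign, an integer S x that lifts the class of x in G / H = Z / p.  So p
    divides a power of S x, hence S x itself, and x lies in H. *)

Set Implicit Arguments.
Unset Strict Implicit.
Unset Printing Implicit Defensive.

Import GRing.Theory Num.Theory.
Local Open Scope ring_scope.

(** * Additive maps *)

Lemma zmod_morphism0 (U V : zmodType) (f : U -> V) : zmod_morphism f -> f 0 = 0.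
Proof. by move=> fB; rewrite -[X in f X](subrr 0) fB subrr. Qed.

Lemma zmod_morphismMz (U V : zmodType) (f : U -> V) : zmod_morphism f ->
  forall (c : int) x, f (x *~ c) = f x *~ c.
Proof.
move=> fB; pose f' : {additive U -> V} :=
  HB.pack_for {additive U -> V} f (GRing.isZmodMorphism.Build _ _ f fB).
by move=> c x; exact: (raddfMz f').
Qed.

Lemma zmod_morphism_sum (U V : zmodType) (f : U -> V) : zmod_morphism f ->
  forall (I : Type) (s : seq I) (P : pred I) (F : I -> U),
  f (\sum_(i <- s | P i) F i) = \sum_(i <- s | P i) f (F i).
Proof.
move=> fB; pose f' : {additive U -> V} :=
  HB.pack_for {additive U -> V} f (GRing.isZmodMorphism.Build _ _ f fB).
by move=> I s P F; exact: (raddf_sum f').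
Qed.

(** * Homogeneous cochains *)

Section HomogeneousCochains.
Variable G : groupType.

Definition translate (g : G) (s : seq G) : seq G := [seq (g * x)%g | x <- s].

Lemma translateM g g' s : translate (g * g')%g s = translate g (translate g' s).
Proof.
by rewrite /translate -map_comp; apply: eq_map => x /=; rewrite mulgA.
Qed.

Lemma translate1 s : translate 1%g s = s.
Proof.
by rewrite /translate -[RHS]map_id; apply: eq_map => x; rewrite mul1g.
Qed.

(** The coboundary of homogeneous cochains, where (g_0, ..., g_k) has degree k.
    The empty list adds a degree -1, so this is the augmented complex: a
    0-cocycle is the coboundary of its constant value. *)
Fixpoint hcob (A : zmodType) (F : seq G -> A) (s : seq G) {struct s} : A :=
  if s is g :: s' then F s' - hcob (fun u => F (g :: u)) s' else 0.

Lemma hcob_comp (A B : zmodType) (tau : A -> B) (F : seq G -> A) s :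
  zmod_morphism tau -> hcob (fun u => tau (F u)) s = tau (hcob F s).
Proof.
move=> tauB; elim: s F => [|g s IHs] F /=; first by rewrite zmod_morphism0.
by rewrite tauB IHs.
Qed.

Lemma hcob_translate (A : zmodType) g (F : seq G -> A) s :
  hcob (fun u => F (translate g u)) s = hcob F (translate g s).
Proof. by elim: s F => [|x s IHs] F //=; rewrite -IHs. Qed.

Fact hcob_zmod_morphism (A : zmodType) : zmod_morphism (@hcob A).
Proof.
move=> F F'; apply/funext => s; rewrite !fctE.
elim: s F F' => [|g s IHs] F F' /=; first by rewrite subr0.
by rewrite (IHs (fun u => F (g :: u))) !opprB addrACA [in RHS]addrACA;
  congr (_ + _); rewrite addrC.
Qed.

HB.instance Definition _ (A : zmodType) :=
  GRing.isZmodMorphism.Build (seq G -> A) (seq G -> A) (@hcob A)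
    (@hcob_zmod_morphism A).

Definition lquot (x y : G) : G := (x^-1 * y)%g.

Lemma lquot_mull g x y : lquot (g * x)%g (g * y)%g = lquot x y.
Proof. by rewrite /lquot invgM -mulgA mulKg. Qed.

(** The usual passage from bar cochains to G-invariant homogeneous ones:
    (g_0, ..., g_k) is sent to f [g_0^-1 g_1, ..., g_(k-1)^-1 g_k]. *)
Definition homogeneous (f : cochain G) (s : seq G) : int :=
  if s is g :: s' then f (pairmap lquot g s') else 0.

Lemma homogeneous_translate f g s :
  homogeneous f (translate g s) = homogeneous f s.
Proof.
case: s => //= x s; congr (f _); elim: s x => //= y s IHs x.
by rewrite IHs lquot_mull.
Qed.

Lemma hcob_homogeneous f : hcob (homogeneous f) = homogeneous (coboundary f).
Proof.
apply/funext => -[|g [|x s]] //.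
have step : forall (f : cochain G) g x s,
    hcob (fun u => f (pairmap lquot g u)) (x :: s)
    = f (pairmap lquot x s) - coboundary f (pairmap lquot g (x :: s)).
  move=> {f g x s} f g x s; elim: s f g x => [|y s IHs] f g x.
    by rewrite [in RHS]/pairmap coboundary1.
  rewrite [LHS]/= [X in _ - X](IHs (cshift (lquot g x) f)).
  rewrite [pairmap _ _ [:: x, y & s]]/= coboundary_cons /cshift.
  have -> : (lquot g x * lquot x y)%g = lquot g y.
    by rewrite /lquot mulgA mulgK.
  by rewrite /=; ring.
by have := step f g x s => /= ->; rewrite subKr.
Qed.

Lemma homogeneous_cup2 (z f : cochain G) s :
  (forall u, size u <> 2 -> z u = 0) ->
  homogeneous (z * f) s =
    if s is [:: g0, g1, g2 & s'] then
      z [:: lquot g0 g1; lquot g1 g2] * homogeneous f (g2 :: s')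
    else 0.
Proof.
move=> z2; case: s => [|g0 [|g1 [|g2 s]]] //.
- by rewrite /= cochainM cup_nil z2 ?mul0r.
- by rewrite /= cochainM cup_cons cup_nil /cshift !z2 // !mul0r addr0.
rewrite /= cochainM /cup; do 2!rewrite big_ord_recl.
rewrite /= (z2 [::]) // (z2 [:: _]) // !mul0r.
rewrite big_ord_recl /= take0 drop0 big1 ?addr0 ?add0r // => i _.
by case: s i => [|x s] [i lti] //=; rewrite z2 ?mul0r.
Qed.

(** Cup products on the left by a 0-cochain and by a 1-cochain, which need not
    be invariant under G. *)
Definition cup0 (v : G -> int) (w : seq G -> int) (s : seq G) : int :=
  if s is g :: _ then v g * w s else 0.

Definition cup1 (u : G -> G -> int) (w : seq G -> int) (s : seq G) : int :=
  if s is [:: g0, g1 & s'] then u g0 g1 * w (g1 :: s') else 0.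

Lemma hcob_mull (a : int) (w : seq G -> int) s :
  hcob (fun u => a * w u) s = a * hcob w s.
Proof. exact: (hcob_comp w s (mulrBr a)). Qed.

(** Prepending a fixed vertex is a contracting homotopy of the augmented
    complex. *)
Lemma cocycle_cons (A : zmodType) (w : seq G -> A) g s : hcob w = 0 ->
  hcob (fun u => w (g :: u)) s = w s.
Proof.
by move=> /(congr1 (@^~ (g :: s))) /= /eqP; rewrite subr_eq0 => /eqP.
Qed.

Lemma hcob_cup0 v w : hcob w = 0 ->
  hcob (cup0 v w) =
    fun s => if s is [:: g0, g1 & s'] then (v g1 - v g0) * w (g1 :: s') else 0.
Proof.
move=> dw; apply/funext => -[|g0 [|g1 s]] //.
rewrite [LHS]/(_ - hcob (fun u => v g0 * w (g0 :: u)) (g1 :: s)).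
by rewrite hcob_mull cocycle_cons // mulrBl.
Qed.

Lemma hcob_cup1 u w : hcob w = 0 ->
  hcob (cup1 u w) =
    fun s => if s is [:: g0, g1, g2 & s'] then
      (u g1 g2 - u g0 g2 + u g0 g1) * w (g2 :: s') else 0.
Proof.
move=> dw; apply/funext => -[|g0 [|g1 [|g2 s]]] //.
transitivity (u g1 g2 * w (g2 :: s) - (u g0 g2 * w (g2 :: s)
    - hcob (fun u' => u g0 g1 * w (g1 :: u')) (g2 :: s))) => //.
by rewrite hcob_mull cocycle_cons //; ring.
Qed.
End HomogeneousCochains.

(** * Descent along powers of a class from a cyclic quotient *)

Section Descent.
Variables (G : groupType) (z : cochain G).
Hypotheses (z2 : forall s, size s <> 2 -> z s = 0) (dz : coboundary z = 0).

Lemma cocycle2 a b c :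
  z [:: b; c] - z [:: (a * b)%g; c] + z [:: a; (b * c)%g] - z [:: a; b] = 0.
Proof.
have <- : coboundary z [:: a; b; c] = 0 by rewrite dz.
by rewrite !coboundary_cons coboundary1 /cshift; ring.
Qed.

Variables (t : G) (r : nat) (l m : int).

(** A 1-cochain that bounds z, at the price of not being invariant under
    translation. *)
Definition primitive (g0 g1 : G) : int := z [:: g0; lquot g0 g1].
(** A 0-cochain that bounds the defect of invariance of primitive under
    translation by t.  The constant l leaves its coboundary unchanged and
    serves to normalize the sum of its translates. *)
Definition primitive_shift (g : G) : int := l - z [:: t; (t^-1 * g)%g].

Lemma primitiveE g0 g1 g2 :
  primitive g1 g2 - primitive g0 g2 + primitive g0 g1
  = z [:: lquot g0 g1; lquot g1 g2].
Proof.
have := cocycle2 g0 (lquot g0 g1) (lquot g1 g2).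
rewrite /primitive /lquot mulVKg mulgA mulgK => /eqP.
lra.
Qed.

Lemma primitive_shiftE g0 g1 :
  primitive (t^-1 * g0)%g (t^-1 * g1)%g - primitive g0 g1
  = primitive_shift g1 - primitive_shift g0.
Proof.
have := cocycle2 t (t^-1 * g0)%g (lquot g0 g1).
rewrite /primitive /primitive_shift /lquot !mulVKg.
rewrite invgM invgK -!mulgA !mulVKg; lra.
Qed.

Variables (A : zmodType) (tau : {additive A -> A}) (E : (seq G -> A) -> Prop).

(** The action of t on cochains, when t acts on the coefficients by tau. *)
Definition twist (F : seq G -> A) (s : seq G) : A := tau (F (translate t^-1 s)).
Definition norm (F : seq G -> A) : seq G -> A := \sum_(j < r) iter j twist F.

Fact twist_zmod_morphism : zmod_morphism twist.
Proof. by move=> F F'; apply/funext => s; rewrite /twist !fctE raddfB. Qed.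

HB.instance Definition _ :=
  GRing.isZmodMorphism.Build (seq G -> A) (seq G -> A) twist
    twist_zmod_morphism.

Lemma iter_twistE j F s :
  iter j twist F s = iter j tau (F (translate (t ^- j) s)).
Proof.
elim: j s => [|j IHj] s; first by rewrite expg0 invg1 translate1.
by rewrite !iterS {1}/twist IHj -translateM expgS invgM.
Qed.

Lemma iter_twistB j F F' :
  iter j twist (F - F') = iter j twist F - iter j twist F'.
Proof. by elim: j => //= j ->; rewrite raddfB. Qed.

Lemma normB F F' : norm (F - F') = norm F - norm F'.
Proof. by rewrite /norm -sumrB; apply: eq_bigr => j _; exact: iter_twistB. Qed.

Lemma twist_hcob F : hcob (twist F) = twist (hcob F).
Proof.
apply/funext => s; rewrite /twist (hcob_comp _ _ (raddfB tau)).
by rewrite (hcob_translate t^-1 F).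
Qed.

Lemma norm_hcob F : hcob (norm F) = norm (hcob F).
Proof.
rewrite raddf_sum; apply: eq_bigr => j _ /=.
by elim: (j : nat) => //= k <-; rewrite twist_hcob.
Qed.

Lemma twist_norm F : twist (norm F) - norm F = iter r twist F - F.
Proof.
rewrite raddf_sum /norm -sumrB /=.
by rewrite -(big_mkord xpredT (fun j => iter j.+1 twist F - iter j twist F))
  telescope_sumr.
Qed.

Lemma norm_twist F : norm (twist F) = twist (norm F).
Proof.
by rewrite raddf_sum; apply: eq_bigr => j _; rewrite -iterSr.
Qed.

(* E is the class of cochains in which the descent takes place; K is the set of
   translations under which primitive and primitive_shift are invariant. *)
Hypothesis E_sub : forall F F', E F -> E F' -> E (F - F').
Hypothesis E_twist : forall F, E F -> E (twist F).
Hypothesis E_period : forall F, E F -> iter r twist F = F.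
Hypothesis E_acyclic :
  forall F, E F -> hcob F = 0 -> exists2 F', E F' & hcob F' = F.

Variable e : A.
Hypothesis tau_e : tau e = e.

Definition scal (c : seq G -> int) (s : seq G) : A := e *~ c s.

Definition invariant (w : seq G -> int) := forall g s, w (translate g s) = w s.

Variable K : G -> Prop.
Hypothesis E_scal :
  forall c, (forall k s, K k -> c (translate k s) = c s) -> E (scal c).
Hypothesis primitive_translate : forall k g0 g1, K k ->
  primitive (k * g0)%g (k * g1)%g = primitive g0 g1.
Hypothesis primitive_shift_translate : forall k g, K k ->
  primitive_shift (k * g)%g = primitive_shift g.
Hypothesis norm_shift :
  forall g, \sum_(j < r) primitive_shift (t ^- j * g)%g = m.

Lemma norm0E F : E F -> twist (norm F) = norm F.
Proof.
by move=> EF; apply/eqP; rewrite -subr_eq0 twist_norm E_period ?subrr.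
Qed.

Lemma twist_scal c : twist (scal c) = scal (fun s => c (translate t^-1 s)).
Proof. by apply/funext => s; rewrite /twist /scal raddfMz tau_e. Qed.

Lemma iter_twist_scal j c :
  iter j twist (scal c) = scal (fun s => c (translate (t ^- j) s)).
Proof.
elim: j => [|j IHj] /=; apply/funext => s.
  by rewrite /scal expg0 invg1 translate1.
by rewrite IHj twist_scal /scal -translateM expgS invgM.
Qed.

Lemma hcob_scal c : hcob (scal c) = scal (hcob c).
Proof.
by apply/funext => s; exact: (hcob_comp c s (mulrzBr e)).
Qed.

(** One step along the zigzag z, primitive, primitive_shift, m.  It removes a
    factor z from a coboundary at the price of a factor m.  The cochain
    (norm y) is again in E and fixed by t, so the step can be repeated. *)
Lemma descent_step w h : invariant w -> hcob w = 0 -> E h -> twist h = h ->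
  hcob h = scal (fun s => if s is [:: g0, g1, g2 & s'] then
    z [:: lquot g0 g1; lquot g1 g2] * w (g2 :: s') else 0) ->
  exists2 y, E y & hcob (norm y) = scal (fun s => m * w s).
Proof.
move=> winv dw Eh th dh.
set uw := scal (cup1 primitive w); set vw := scal (cup0 primitive_shift w).
have Eu : E uw.
  apply: E_scal => k [|g0 [|g1 s]] //= Kk.
  by rewrite primitive_translate // (winv k (g1 :: s)).
have Ev : E vw.
  apply: E_scal => k [|g s] //= Kk.
  by rewrite primitive_shift_translate // (winv k (g :: s)).
have duw : hcob uw = hcob h.
  rewrite dh hcob_scal hcob_cup1 //; congr scal; apply/funext.
  by move=> [|g0 [|g1 [|g2 s]]] //; rewrite primitiveE.
have dvw : hcob vw = twist uw - uw.
  rewrite hcob_scal hcob_cup0 // twist_scal; apply/funext => s.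
  rewrite fctE /scal -mulrzBr; congr (_ *~ _).
  case: s => [|g0 [|g1 s]] //=.
  by rewrite (winv t^-1%g (g1 :: s)) -mulrBl primitive_shiftE.
have [||y Ey dy] := E_acyclic (F := uw - h); first exact: E_sub.
  by rewrite raddfB /= duw subrr.
have [||y' Ey' dy'] := E_acyclic (F := vw - (twist y - y)).
- by apply: E_sub => //; apply: E_sub => //; exact: E_twist.
- rewrite raddfB /= raddfB /= twist_hcob dy [twist (_ - _)](iter_twistB 1) /=.
  by rewrite th dvw (opprB uw h) addrA subrK subrr.
exists y' => //; rewrite norm_hcob dy' !normB norm_twist norm0E // subrr subr0.
apply/funext => s; rewrite /norm.
transitivity (\sum_(j < r)
    scal (fun s => cup0 primitive_shift w (translate (t ^- j) s)) s).
  by rewrite fct_sumE; apply: eq_bigr => j _; rewrite iter_twist_scal.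
(* On the empty list the product with w is 0, while w itself vanishes there
   because its coboundary vanishes on one-element lists. *)
rewrite /scal -mulrz_sumr; congr (_ *~ _); case: s => [|g s].
  rewrite big1 //; have := congr1 (@^~ [:: 1%g]) dw => /=.
  by rewrite subr0 => ->; rewrite mulr0.
rewrite -(norm_shift g) mulr_suml; apply: eq_bigr => j _.
by rewrite -(winv (t ^- j)%g (g :: s)).
Qed.

Lemma E_norm F : E F -> E (norm F).
Proof.
move=> EF; have E0 : E 0 by rewrite -(subrr F); exact: E_sub.
apply: big_ind => // [F1 F2 E1 E2|j _].
  by rewrite -[F2]opprK -[- F2]sub0r; apply: E_sub => //; exact: E_sub.
by elim: (j : nat) => //= k; exact: E_twist.
Qed.

Lemma norm_nil F : norm F [::] = \sum_(j < r) iter j tau (F [::]).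
Proof.
rewrite /norm fct_sumE; apply: eq_bigr => j _.
exact: iter_twistE.
Qed.

Lemma cocycle_z : z \in cocycle (G := G).
Proof.
apply/cocycleP; split=> //; exists 3 => s; rewrite ltnNge => s3.
by apply: z2 => s2; rewrite s2 in s3.
Qed.

Lemma descent_iter n (c : int) h : E h -> twist h = h ->
  hcob h = scal (fun s => c * homogeneous (z ^+ n.+1) s) ->
  exists2 y, E y & norm y [::] = e *~ (c * m ^+ n.+1).
Proof.
have step k c' h' : E h' -> twist h' = h' ->
    hcob h' = scal (fun s => c' * homogeneous (z ^+ k.+1) s) ->
    exists2 y, E y &
      hcob (norm y) = scal (fun s => (m * c') * homogeneous (z ^+ k) s).
  move=> Eh th dh.
  have [| | |y Ey dy] :=
    @descent_step (fun s => c' * homogeneous (z ^+ k) s) h' _ _ Eh th.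
  - by move=> g s; rewrite homogeneous_translate.
  - have /cocycleP[_ dzk] := rpredX k cocycle_z.
    apply/funext => s; rewrite hcob_mull hcob_homogeneous dzk.
    by case: s => [|g s]; rewrite ?mulr0.
  - rewrite dh; congr scal; apply/funext => s.
    rewrite exprS homogeneous_cup2 //.
    by case: s => [|g0 [|g1 [|g2 s]]]; rewrite ?mulr0 // mulrCA.
  by exists y => //; rewrite dy; congr scal; apply/funext => s; rewrite mulrA.
elim: n c h => [|n IHn] c h Eh th dh; have [y Ey dy] := step _ _ _ Eh th dh.
  exists y => //; have := congr1 (@^~ [:: 1%g]) dy.
  rewrite /= subr0 /scal => ->; congr (_ *~ _).
  have -> : homogeneous (z ^+ 0) [:: 1%g] = 1 by [].
  by rewrite mulr1 mulrC.
have [y' Ey' ey'] := IHn _ _ (E_norm Ey) (norm0E Ey) dy.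
by exists y' => //; rewrite ey' (exprS m n.+1); congr (_ *~ _); ring.
Qed.

(** If a power of z is a coboundary, then a power of m times e is a trace from
    the degree -1 part of E. *)
Theorem descent n (f : cochain G) : z ^+ n.+1 = coboundary f ->
  exists2 y, E y & \sum_(j < r) iter j tau (y [::]) = e *~ m ^+ n.+1.
Proof.
move=> df; have [||| y Ey ey] := @descent_iter n 1 (scal (homogeneous f)).
- by apply: E_scal => k s _; rewrite homogeneous_translate.
- rewrite twist_scal; congr scal; apply/funext => s.
  by rewrite homogeneous_translate.
- rewrite hcob_scal hcob_homogeneous df; congr scal; apply/funext => s.
  by rewrite mul1r.
by exists y => //; rewrite -norm_nil ey mul1r.
Qed.
End Descent.

(** * The cocycle of the Bockstein *)

(** Up to the additive constant k * l - S t, the cochain k * primitive_shift is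
    S g - S (t^-1 g), so that the sum telescopes. *)
Lemma norm_primitive_shift (G : groupType) (z : cochain G) (S : G -> int)
    (k l : int) (t : G) : k != 0 ->
  (forall a b, k * z [:: a; b] = S a + S b - S (a * b)%g) ->
  (forall g, S (t ^- `|k| * g)%g = S g) ->
  forall g, \sum_(j < `|k|) primitive_shift z t l (t ^- j * g)%g
            = Num.sg k * (k * l - S t).
Proof.
move=> k0 kz St g; apply: (mulfI k0); rewrite mulr_sumr.
pose T j := S (t ^- j * g)%g.
rewrite (eq_bigr (fun j : 'I_ `|k| => (k * l - S t) - (T j.+1 - T j))).
  rewrite sumrB sumr_const card_ord -(big_mkord xpredT (fun j => T j.+1 - T j)).
  rewrite telescope_sumr // /T St expg0 invg1 mul1g subrr subr0.
  by rewrite mulrA (mulrC k (Num.sg k)) -normrEsg -mulr_natl natz abszE.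
move=> j _; rewrite /primitive_shift /T mulrBr kz mulVKg mulgA -invgM -expgSr.
by ring.
Qed.

(** The cocycle of the extension is the carry S a + S b - S (a b), divided by
    k = i 1, for a lifting S of G to the integers; k is the index up to sign,
    because q identifies Z / k with G / H. *)
Lemma bockstein_cocycle (G : groupType) (H : groupClosed G)
    (nH : normal_subgroup H) (p : nat) (beta : cohomology G) :
  ([set: coset H] #= `I_p)%card -> is_bockstein nH beta ->
  exists (k : int) (q : int -> quotient_group nH) (S : G -> int)
         (z : cocycle_type G),
  [/\ `|k|%N = p, {morph q : m n / m + n >-> (m * n)%g},
      forall n, q n = 1%g <-> (k %| n)%Z &
      [/\ forall g, q (S g) = quotient_proj nH g,
          forall g g', quotient_proj nH g = quotient_proj nH g' -> S g = S g' &
      [/\ beta = cohomology_class z,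
          forall s, size s <> 2 -> val z s = 0,
          forall a b, k * val z [:: a; b] = S a + S b - S (a * b)%g &
          forall s s', map (quotient_proj nH) s = map (quotient_proj nH) s' ->
            val z s = val z s']]].
Proof.
move=> indexH [i [q [beta_hat [[iD i_inj qD q_surj q_ker] [sigma [z]]]]]].
move=> [sigmaK iz z2 ->] ->.
have i0 : i 0 = 0 by apply: (addrI (i 0)); rewrite -iD !addr0.
have iB : zmod_morphism i.
  by move=> m n; apply: (addIr (i n)); rewrite subrK -iD subrK.
have iE n : i n = i 1 * n.
  by rewrite -{1}[n]intz (zmod_morphismMz iB) mulrzz.
have k0 : i 1 != 0 by apply/eqP; rewrite -i0 => /i_inj.
have q0 : q 0 = 1%g by apply: (@mulgI _ (q 0)); rewrite mulg1 -qD addr0.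
have q1 n : q n = 1%g <-> (i 1 %| n)%Z.
  rewrite q_ker; split=> [[m <-]|/dvdzP[m ->]]; first by rewrite iE dvdz_mulr.
  by exists m; rewrite iE mulrC.
have qmod m n : (i 1 %| m - n)%Z -> q m = q n.
  by move=> /q1 kmn; rewrite -[m](subrK n) qD kmn mul1g.
have qinj m n : q m = q n -> (i 1 %| m - n)%Z.
  move=> qmn; apply/q1; apply: (@mulIg _ (q n)).
  by rewrite -qD subrK mul1g.
exists (i 1), q, (fun g => sigma (quotient_proj nH g)).
exists (cocycle_pullback (quotient_proj nH) z); split=> //.
  suff : (`I_ `|i 1| #= `I_p)%card by move=> /card_eq_II.
  apply: card_eq_trans indexH; rewrite card_eq_sym.
  pose f (j : nat) : quotient_group nH := q j.
  have finj : {in `I_ `|i 1| &, injective f}.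
    move=> a b; rewrite !in_setE /= => ai bi /qinj; rewrite dvdzE => kab.
    apply/eqP; rewrite -[a == b]/(a%:Z == b%:Z).
    rewrite -subr_eq0 -absz_eq0 -leqn0 leqNgt.
    by apply/negP => ab_gt0; have := dvdn_leq ab_gt0 kab; lia.
  have <- : (f @` `I_ `|i 1| = setT)%classic; last exact: inj_card_eq.
  apply/seteqP; split=> // a _; have [n <-] := q_surj a.
  exists `|(n %% i 1)%Z|%N.
    by rewrite /= -ltz_nat gez0_abs ?modz_ge0 ?ltz_mod // abszE.
  rewrite /f gez0_abs ?modz_ge0 //; apply/esym/qmod.
  by rewrite {1}(divz_eq n (i 1)) addrK dvdz_mull.
split=> //; first by move=> g g' ->.
split=> //.
- by rewrite inflation_class.
- by move=> s s2 /=; rewrite /cochain_pullback z2 // size_map.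
- by move=> a b; rewrite -iE iz gmulfM.
- by move=> s s' /= ss'; rewrite /cochain_pullback ss'.
Qed.

(** * Averaging over a group on a projective module *)

Section FinitelySupportedSums.
Variables (R N : zmodType) (X : choiceType).
Implicit Types (phi : X -> R -> N) (x : {malg R[X]}).

Definition malg_sum phi x : N := \sum_(b <- msupp x) phi b x@_b.

Lemma malg_sumw (d : {fset X}) phi x : (forall b, phi b 0 = 0) ->
  (msupp x `<=` d)%fset -> malg_sum phi x = \sum_(b <- d) phi b x@_b.
Proof.
move=> phi0 xd; rewrite /malg_sum (big_fset_incl _ xd) //= => b _.
by move=> /mcoeff_outdom ->.
Qed.

Lemma malg_sumB phi : (forall b, zmod_morphism (phi b)) ->
  zmod_morphism (malg_sum phi).
Proof.
move=> phiB x y; have phi0 b : phi b 0 = 0 by exact: zmod_morphism0.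
rewrite (malg_sumw phi0 (msuppB_le x y)).
rewrite (malg_sumw phi0 (fsubsetUl _ (msupp y))).
rewrite (malg_sumw phi0 (fsubsetUr (msupp x) _)) -sumrB.
by apply: eq_bigr => b _; rewrite mcoeffB phiB.
Qed.

Lemma malg_sum0 phi : malg_sum phi 0 = 0.
Proof. by rewrite /malg_sum msupp0 big_seq_fset0. Qed.

Lemma malg_sumU phi c b : phi b 0 = 0 -> malg_sum phi << c *g b >> = phi b c.
Proof.
move=> phi0; rewrite /malg_sum msuppU; case: eqP => [->|_].
  by rewrite big_seq_fset0.
by rewrite big_seq_fset1 mcoeffUU.
Qed.

Lemma eq_malg_zmod_morphism (f g : {malg R[X]} -> N) : zmod_morphism f ->
  zmod_morphism g -> (forall c b, f << c *g b >> = g << c *g b >>) -> f =1 g.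
Proof.
move=> fB gB fg x.
have sum_morph (h : {malg R[X]} -> N) (hB : zmod_morphism h) :
    h x = \sum_(b <- msupp x) h << x@_b *g b >>.
  rewrite {1}[x]monalgE.
  exact: zmod_morphism_sum.
by rewrite (sum_morph f) // (sum_morph g) //; apply: eq_bigr => b _.
Qed.
End FinitelySupportedSums.

Lemma malg_scaleU (R : nzRingType) (X : choiceType) (a c : R) (b : X) :
  a *: << c *g b >> = << a * c *g b >> :> {malg R[X]}.
Proof. by apply/malgP => b'; rewrite mcoeffZ !mcoeffU mulrnAr. Qed.

Definition gact (G : groupType) (M : lmodType (group_ring G)) (g : G) (m : M) :
  M := (<< g >> : group_ring G) *: m.

Section Averaging.
Variables (K : groupType) (M : lmodType (group_ring K)).

Lemma gactM (g h : K) (m : M) : gact (g * h)%g m = gact g (gact h m).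
Proof. by rewrite /gact scalerA [_ * _]gring_mulUU mulr1. Qed.

Lemma gact1 (m : M) : gact 1%g m = m.
Proof. exact: scale1r. Qed.

Lemma gactB (g : K) : zmod_morphism (gact (M := M) g).
Proof. by move=> m n; rewrite /gact scalerBr. Qed.

Lemma gringU (c : int) (h : K) : << c *g h >> = (<< h >> : group_ring K) *~ c.
Proof. by rewrite -{1}[c]intz; exact: (raddfMz (mkmalgU h)). Qed.

Lemma gring_actE (y : group_ring K) (m : M) :
  malg_sum (fun h c => gact h m *~ c) (y : {malg int[K]}) = y *: m.
Proof.
apply: (eq_malg_zmod_morphism (g := fun y : group_ring K => y *: m)) => [||c h].
- by apply: malg_sumB => h a b; rewrite mulrzBr.
- by move=> a b; rewrite scalerBl.
rewrite malg_sumU ?mulr0z // /gact.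
by rewrite (gringU c h) /gact scalerMzl.
Qed.

Lemma gact_scalable (N : lmodType (group_ring K)) (f : M -> N) :
  zmod_morphism f -> (forall h m, f (gact h m) = gact h (f m)) -> scalable f.
Proof.
move=> fB fG y m.
apply: (eq_malg_zmod_morphism (f := fun y : group_ring K => f (y *: m))
  (g := fun y : group_ring K => y *: f m)) => [a b|a b|c h].
- by rewrite scalerBl fB.
- by rewrite scalerBl.
by rewrite gringU -!scalerMzl zmod_morphismMz // [f _]fG.
Qed.

Definition free_cover (x : {malg (group_ring K)[M]}) : M :=
  malg_sum (fun b y => y *: b) x.

Fact free_cover_zmod_morphism : zmod_morphism free_cover.
Proof. by apply: malg_sumB => b y y'; rewrite scalerBl. Qed.

HB.instance Definition _ := GRing.isZmodMorphism.Build _ _ free_cover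
  free_cover_zmod_morphism.

Fact free_cover_scalable : scalable free_cover.
Proof.
move=> a; apply: (eq_malg_zmod_morphism (f := fun x => free_cover (a *: x))
  (g := fun x => a *: free_cover x)) => [x y|x y|c b].
- by rewrite scalerBr raddfB.
- by rewrite raddfB /= scalerBr.
rewrite malg_scaleU.
by rewrite /free_cover !malg_sumU ?scale0r // scalerA.
Qed.

HB.instance Definition _ := GRing.isScalable.Build _ _ _ _ free_cover
  free_cover_scalable.

(** The additive extension, from the Z-basis of the free module on M, of the
    map that sends h b to Phi h (h b).  With Phi the constant identity it is
    free_cover. *)
Definition twisted_sum (N : zmodType) (Phi : K -> M -> N)
    (x : {malg (group_ring K)[M]}) : N :=
  malg_sum (fun b (y : group_ring K) =>
    malg_sum (fun h c => Phi h (gact h b) *~ c) (y : {malg int[K]})) x.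

(** A projective module M is a direct summand of the free module on the set M.
    A splitting yields an endomorphism a of the abelian group M whose
    conjugates by K sum to the identity, only finitely many being nonzero at
    each vector; for additive Phi h, T Phi is the sum over h of the composites
    of Phi h with the conjugate of a by h. *)
Theorem projective_averaging : projective M ->
  exists T : (K -> M -> M) -> M -> M,
  [/\ zmod_morphism T, forall Phi, zmod_morphism (T Phi),
      T (fun=> idfun) = idfun,
      forall f Phi, zmod_morphism f ->
        T (fun k b => f (Phi k b)) = (fun m => f (T Phi m)) &
      forall Phi h m,
        T Phi (gact h m) = T (fun k b => Phi (h * k)%g (gact h b)) m].
Proof.
move=> projM.
have cover_surj (m : M) : exists x, free_cover x = m.
  by exists << 1 *g m >>; rewrite /free_cover malg_sumU ?scale0r // scale1r.
have [s sK] := projM _ _ free_cover idfun cover_surj.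
have inner_morph (N : zmodType) (phi : K -> N) :
    zmod_morphism (malg_sum (fun h (c : int) => phi h *~ c)).
  by apply: malg_sumB => h a b; rewrite mulrzBr.
have sum_morph Phi : zmod_morphism (@twisted_sum M Phi).
  by apply: malg_sumB => b x y; exact: inner_morph.
have inner_U (N : zmodType) (phi : K -> N) (c : int) h :
    malg_sum (fun h (c : int) => phi h *~ c) << c *g h >> = phi h *~ c.
  by rewrite malg_sumU ?mulr0z.
exists (fun Phi m => twisted_sum Phi (s m)); split.
- move=> Phi Psi; apply/funext => m.
  rewrite !fctE /twisted_sum /malg_sum -sumrB.
  apply: eq_bigr => b _; rewrite -sumrB; apply: eq_bigr => h _.
  by rewrite mulrzBl.
- by move=> Phi m n; rewrite raddfB; exact: sum_morph.
- apply/funext => m; rewrite -[in RHS](sK m : free_cover (s m) = m).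
  move: (s m) => x; apply: (eq_malg_zmod_morphism
    (f := twisted_sum (fun=> idfun)) (g := free_cover)) => [||y b].
  + exact: sum_morph.
  + exact: free_cover_zmod_morphism.
  rewrite /free_cover /twisted_sum malg_sumU; last exact: malg_sum0.
  by rewrite malg_sumU ?scale0r // -gring_actE.
- move=> f Phi fB; apply/funext => m; rewrite /twisted_sum /malg_sum.
  rewrite zmod_morphism_sum //; apply: eq_bigr => b _.
  rewrite zmod_morphism_sum //; apply: eq_bigr => h _.
  by rewrite zmod_morphismMz.
- move=> Phi h m; rewrite {1}/gact linearZZ.
  move: (s m) => x.
  apply: (eq_malg_zmod_morphism (R := group_ring K) (X := M) (N := M)
     (f := fun x => twisted_sum Phi ((<<h>> : group_ring K) *: x))
    (g := twisted_sum (fun k b => Phi (h * k)%g (gact h b)))) => [x1 x2||y b].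
  + by rewrite scalerBr; exact: sum_morph.
  + exact: sum_morph.
  rewrite malg_scaleU.
  rewrite /twisted_sum !malg_sumU ?malg_sum0 //.
  have inner_shift : (fun y : group_ring K => malg_sum
        (fun k c => Phi k (gact k b) *~ c) ((<< h >> : group_ring K) * y))
      =1 malg_sum (fun k c => Phi (h * k)%g (gact h (gact k b)) *~ c).
    apply: eq_malg_zmod_morphism => [u v||c k]; last 1 first.
    + have -> : (<< h >> : group_ring K) * << c *g k >> = << c *g (h * k)%g >>.
        by rewrite [LHS]gring_mulUU mul1r.
      by rewrite !inner_U gactM.
    + by rewrite mulrBr; exact: inner_morph.
    + exact: inner_morph.
  exact: inner_shift.
Qed.
End Averaging.

(** * Equivariant cochains and transfer *)

Section EquivariantCochains.
Variables (G : groupType) (H : groupClosed G) (M : lmodType (group_ring G)).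
Local Notation MH := (restrict_scalars (gring_map (@subgroup_incl G H)) M).

Lemma gact_restrict (N : lmodType (group_ring G)) (h : subgroup_type H) (m : N) :
  gact (M := restrict_scalars (gring_map (@subgroup_incl G H)) N) h m
  = gact (val h) m.
Proof. by rewrite /gact [LHS]/(gring_map _ _ *: (m : N)) gring_mapU. Qed.

Definition equivariant (N : lmodType (group_ring G)) (f : M -> N) :=
  zmod_morphism f /\ forall h, h \in H -> forall m, f (gact h m) = gact h (f m).

Definition equivariant_cochain (F : seq G -> M -> M) : Prop :=
  (forall s, zmod_morphism (F s)) /\
  forall h, h \in H -> forall s m, F (translate h s) (gact h m) = gact h (F s m).

(** Averaging over the prepended vertex h turns the contracting homotopy
    F |-> F (h :: s) into one that preserves equivariance. *)
Lemma equivariant_cochain_acyclic F : projective MH ->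
  equivariant_cochain F -> hcob F = 0 ->
  exists2 F', equivariant_cochain F' & hcob F' = F.
Proof.
move=> projM [FB FE] dF.
have [T [TB TPhiB T1 Tcomp Tact]] := projective_averaging projM.
pose F' s := T (fun h : subgroup_type H => F (val h :: s)).
exists F'.
  split=> [s|h hH s m]; first exact: TPhiB.
  pose h' : subgroup_type H := Sub h hH.
  rewrite /F' -(gact_restrict h') Tact.
  have -> : (fun k (b : M) =>
        F (val (h' * k)%g :: translate h s) (gact (M := MH) h' b))
      = (fun k b => gact h (F (val k :: s) b)).
    apply/funext => k; apply/funext => b.
    by rewrite gact_restrict -(FE h hH (val k :: s)) valM.
  rewrite (Tcomp (gact h) (fun k => F (val k :: s))) //.
  exact: (@gactB G M h).
apply/funext => s; rewrite /F'.
rewrite (hcob_comp (fun s (h : subgroup_type H) => F (val h :: s)) s TB).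
have -> : hcob (fun s (h : subgroup_type H) => F (val h :: s)) s
    = (fun k m => F s m).
  apply/funext => k.
  have evalB : zmod_morphism (fun Phi : subgroup_type H -> M -> M => Phi k).
    by [].
  by rewrite -[LHS](hcob_comp _ s evalB) cocycle_cons.
by rewrite (Tcomp (F s) (fun=> idfun)) // T1.
Qed.

Section RestrictLinear.
Variables (X Y : lmodType (group_ring G)) (f : {linear X -> Y}).

Definition restrict_linear :
    restrict_scalars (gring_map (@subgroup_incl G H)) X ->
    restrict_scalars (gring_map (@subgroup_incl G H)) Y := f.

Fact restrict_linear_zmod_morphism : zmod_morphism restrict_linear.
Proof. by move=> x y; exact: (raddfB f). Qed.

Fact restrict_linear_scalable : scalable restrict_linear.
Proof. by move=> a x; exact: (linearZZ f). Qed.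

HB.instance Definition _ := GRing.isZmodMorphism.Build _ _ restrict_linear
  restrict_linear_zmod_morphism.
HB.instance Definition _ := GRing.isScalable.Build _ _ _ _ restrict_linear
  restrict_linear_scalable.
End RestrictLinear.

Hypothesis nH : normal_subgroup H.

Lemma conj_mem t h : h \in H -> (t^-1 * (h * t))%g \in H.
Proof. by move=> hH; exact: (@nH h t hH). Qed.

Variables (t : G) (r : nat).
Hypotheses (tr : (t ^+ r)%g \in H).

Lemma gactVK (N : lmodType (group_ring G)) g :
  cancel (gact (M := N) g^-1%g) (gact g).
Proof. by move=> m; rewrite -gactM mulgV gact1. Qed.

(** When r is the index and the powers of t represent the cosets of H, this is
    the transfer from H to G. *)
Definition transfer (N : lmodType (group_ring G)) (f : M -> N) (m : M) : N :=
  \sum_(j < r) gact (t ^+ j)%g (f (gact (t ^- j)%g m)).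

Lemma transfer_equivariant (N : lmodType (group_ring G)) (f : M -> N) :
  equivariant f -> equivariant (transfer f).
Proof.
move=> [fB fH]; split=> [m m'|h hH m].
  by rewrite /transfer -sumrB; apply: eq_bigr => j _; rewrite gactB fB gactB.
rewrite /transfer (zmod_morphism_sum (gactB (M := N) h)); apply: eq_bigr => j _.
have hj : ((t ^+ j)^-1 * (h * t ^+ j))%g \in H by exact: conj_mem.
rewrite -!gactM.
have -> : (t ^- j * h)%g = ((t ^+ j)^-1 * (h * t ^+ j) * t ^- j)%g.
  by rewrite -!mulgA mulgV mulg1.
rewrite (gactM _ (t ^- j)%g m) fH // -(gactM _ _ (f _)).
by rewrite mulVKg.
Qed.

(** Conjugating by t shifts the summation index, and the boundary terms agree
    since t ^+ r lies in H. *)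
Lemma transfer_generator (N : lmodType (group_ring G)) (f : M -> N) m :
  equivariant f -> transfer f (gact t m) = gact t (transfer f m).
Proof.
move=> [fB fH]; pose T j := gact (t ^+ j)%g (f (gact (t ^- j * t)%g m)).
apply/eqP; rewrite -subr_eq0 /transfer (zmod_morphism_sum (gactB (M := N) t)).
rewrite -sumrB (eq_bigr (fun j : 'I_r => - (T j.+1 - T j))).
  rewrite sumrN -(big_mkord xpredT (fun j => T j.+1 - T j)) telescope_sumr //.
  rewrite /T expg0 invg1 mul1g gact1 gactM -fH //.
  by rewrite gactVK subrr oppr0.
move=> j _; rewrite /T opprB -!gactM; congr (_ - _).
by rewrite -expgS expgS invgM mulgVK.
Qed.

Hypothesis cover : forall g : G, exists i h, h \in H /\ g = (t ^+ i * h)%g.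

Lemma transfer_gact (N : lmodType (group_ring G)) (f : M -> N) g m :
  equivariant f -> transfer f (gact g m) = gact g (transfer f m).
Proof.
move=> fE; have [i [h [hH ->]]] := cover g.
rewrite gactM [in RHS]gactM -(transfer_equivariant fE).2 //.
elim: i (gact h m) => [|i IHi] {}m; first by rewrite expg0 !gact1.
by rewrite expgS !gactM transfer_generator // IHi.
Qed.

(** Higman's criterion: an H-linear lifting of f, composed with phi and then
    transferred, lifts f composed with the transfer of phi. *)
Theorem transfer_projective (phi : M -> M) : projective MH ->
  equivariant phi -> transfer phi =1 id -> projective M.
Proof.
move=> projM [phiB phiH] phi1 X Y g f gsurj.
have [h hg] := projM _ _ (restrict_linear g) (restrict_linear f) gsurj.
have hE : equivariant (N := X) (fun m => h (phi m)).
  split=> [m m'|k kH m]; first by rewrite phiB raddfB.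
  pose k' : subgroup_type H := Sub k kH.
  rewrite phiH // -(gact_restrict k') -(gact_restrict k' (h (phi m) : X)).
  by rewrite /gact linearZZ.
have tB := (transfer_equivariant hE).1.
have tG := gact_scalable tB (fun k m => transfer_gact k m hE).
pose h' : {linear M -> X} :=
  HB.pack_for {linear M -> X} (transfer (fun m => h (phi m) : X))
  (GRing.isZmodMorphism.Build _ _ _ tB) (GRing.isScalable.Build _ _ _ _ _ tG).
exists h' => m /=; rewrite -[in RHS](phi1 m) /transfer !raddf_sum.
apply: eq_bigr => j _.
apply: etrans (linearZZ g _ _) (etrans _ (esym (linearZZ f _ _))).
by congr (_ *: _); exact: hg.
Qed.
End EquivariantCochains.

(** * Moore's condition and projectivity *)

Section NilpotentBockstein.
Variables (G : groupType) (H : groupClosed G) (nH : normal_subgroup H).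
Variables (k : int) (q : int -> quotient_group nH) (S : G -> int) (z : cochain G).
Hypotheses (k0 : k != 0) (qD : {morph q : m n / m + n >-> (m * n)%g}).
Hypothesis q1 : forall n, q n = 1%g <-> (k %| n)%Z.
Hypothesis qS : forall g, q (S g) = quotient_proj nH g.
Hypothesis S_proj : forall g g',
  quotient_proj nH g = quotient_proj nH g' -> S g = S g'.
Hypothesis z2 : forall s, size s <> 2 -> z s = 0.
Hypothesis dz : coboundary z = 0.
Hypothesis kz : forall a b, k * z [:: a; b] = S a + S b - S (a * b)%g.
Hypothesis z_proj : forall s s',
  map (quotient_proj nH) s = map (quotient_proj nH) s' -> z s = z s'.
Variables (n : nat) (f : cochain G).
Hypothesis zn : z ^+ n.+1 = coboundary f.

Lemma proj_eq1 g : quotient_proj nH g = 1%g <-> g \in H.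
Proof.
have := quotient_projP nH 1%g g; rewrite invg1 mul1g => <-.
by split=> /esym.
Qed.

Lemma dvd_S g : (k %| S g)%Z <-> g \in H.
Proof. by rewrite -q1 qS proj_eq1. Qed.

Lemma q0 : q 0 = 1%g.
Proof. by apply: (@mulgI _ (q 0)); rewrite mulg1 -qD addr0. Qed.

Lemma q_mod m m' : (k %| m - m')%Z <-> q m = q m'.
Proof.
rewrite -q1; split=> [qmm'|qmm'].
  by rewrite -[m](subrK m') qD qmm' mul1g.
by apply: (@mulIg _ (q m')); rewrite -qD subrK mul1g.
Qed.

Lemma q_nat (j : nat) a : q (a * j%:Z) = (q a ^+ j)%g.
Proof.
elim: j => [|j IHj]; first by rewrite mulr0 q0.
by rewrite intS mulrDr mulr1 qD IHj expgS.
Qed.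

Lemma proj_mull h g :
  h \in H -> quotient_proj nH (h * g)%g = quotient_proj nH g.
Proof. by move=> /proj_eq1 h1; rewrite quotient_projM h1; exact: mul1g. Qed.

Lemma proj_expg g j :
  quotient_proj nH (g ^+ j)%g = (quotient_proj nH g ^+ j)%g.
Proof. by elim: j => // j IHj; rewrite !expgS quotient_projM IHj. Qed.

(** The descent with trivial integer coefficients, along x itself. *)
Lemma no_torsion_outside x p0 :
  prime `|k|%N -> x \notin H -> prime p0 -> ~ has_order x p0.
Proof.
move=> pr_k xH pr0 [p0_gt0 xp0 _].
have kS : ~ (k %| S x)%Z by move=> /dvd_S; rewrite (negPf xH).
(* The class of x in Z / k is nonzero and killed by p0. *)
have p0E : p0 = `|k|%N.
  have /q1 : q (S x * p0%:Z) = 1%g.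
    by rewrite q_nat qS -proj_expg xp0.
  rewrite dvdzE abszM Euclid_dvdM // => /orP[/kS //|].
  by rewrite dvdn_prime2 // => /eqP.
have shift := norm_primitive_shift (t := x) 0 k0 kz.
rewrite mulr0 sub0r -p0E xp0 in shift.
have iter_id j (a : int) : iter j idfun a = a by elim: j => //= j ->.
have period (F : seq G -> int) : True -> iter p0 (twist x idfun) F = F.
  move=> _; apply/funext => s.
  by rewrite iter_twistE iter_id xp0 invg1 translate1.
have acyclic (F : seq G -> int) : True -> hcob F = 0 ->
    exists2 F', True & hcob F' = F.
  move=> _ dF; exists (fun s => F (1%g :: s)) => //.
  by apply/funext => s; exact: cocycle_cons.
have invl g0 g1 y : y = 1%g ->
    primitive z (y * g0)%g (y * g1)%g = primitive z g0 g1.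
  by move=> ->; rewrite !mul1g.
have invl' g y : y = 1%g ->
    primitive_shift z x 0 (y * g)%g = primitive_shift z x 0 g.
  by move=> ->; rewrite !mul1g.
have S1 g : S (1^-1 * g)%g = S g by rewrite invg1 mul1g.
have [y _ yE] := descent z2 dz (E := fun=> True) (fun _ _ _ _ => I)
  (fun _ _ => I) period acyclic (e := 1) (erefl _) (K := fun y => y = 1%g)
  (fun _ _ => I) (fun y g0 g1 => @invl g0 g1 y) (fun y g => @invl' g y)
  (shift S1) zn.
apply: kS; rewrite dvdzE.
have := congr1 absz yE; under eq_bigr do rewrite iter_id.
rewrite sumr_const card_ord intz abszX abszM abszN absz_sg k0 mul1n p0E => pS.
have : (`|k| %| `|S x| ^ n.+1)%N by rewrite -pS -mulr_natr abszM natz dvdn_mull.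
by rewrite Euclid_dvdX // => /andP[].
Qed.

Section Projective.
Variable M : lmodType (group_ring G).
Local Notation MH := (restrict_scalars (gring_map (@subgroup_incl G H)) M).
Hypothesis projM : projective MH.

Definition conj_endo (t : G) (a : M -> M) (m : M) : M :=
  gact t (a (gact t^-1%g m)).

Fact conj_endo_zmod_morphism t : zmod_morphism (conj_endo t).
Proof. by move=> a b; apply/funext => m; rewrite /conj_endo !fctE gactB. Qed.

HB.instance Definition _ t := GRing.isZmodMorphism.Build (M -> M) (M -> M)
  (conj_endo t) (conj_endo_zmod_morphism t).

Lemma iter_conj_endo t j a m :
  iter j (conj_endo t) a m = gact (t ^+ j)%g (a (gact (t ^- j)%g m)).
Proof.
elim: j m => [|j IHj] m; first by rewrite expg0 invg1 !gact1.
by rewrite iterS {1}/conj_endo IHj -!gactM !expgS invgM.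
Qed.

Lemma equivariant_cochainB (F F' : seq G -> M -> M) :
  equivariant_cochain H F -> equivariant_cochain H F' ->
  equivariant_cochain H (F - F').
Proof.
move=> [FB FH] [F'B F'H]; split=> [s m m'|h hH s m]; rewrite !fctE.
  by rewrite FB F'B !opprB addrACA [in RHS]addrACA; congr (_ + _); rewrite addrC.
by rewrite FH // F'H // gactB.
Qed.

Lemma equivariant_cochain_twist t (F : seq G -> M -> M) :
  equivariant_cochain H F -> equivariant_cochain H (twist t (conj_endo t) F).
Proof.
move=> [FB FH]; split=> [s m m'|h hH s m]; rewrite /twist /= /conj_endo.
  by rewrite gactB FB gactB.
have hH' := conj_mem nH t hH.
rewrite -translateM -(gactM t^-1%g).
have -> : (t^-1 * h = (t^-1 * (h * t)) * t^-1)%g.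
  by rewrite -!mulgA mulgV mulg1.
by rewrite translateM gactM FH // -!gactM mulVKg.
Qed.

(** The descent with coefficients in the endomorphisms of M on which t acts by
    conjugation, applied to the identity. *)
Theorem projective_of_nilpotent : projective M.
Proof.
pose t : G := repr (q 1 : coset H).
have proj_t : quotient_proj nH t = q 1 by exact: quotient_proj_repr.
have proj_tX j : quotient_proj nH (t ^+ j)%g = q j%:Z.
  by rewrite proj_expg proj_t -q_nat mul1r.
have trH : (t ^+ `|k|)%g \in H.
  by apply/proj_eq1; rewrite proj_tX; apply/q1; rewrite dvdzE.
have cover g : exists i h, h \in H /\ g = (t ^+ i * h)%g.
  exists `|(S g %% k)%Z|%N, (t ^- `|(S g %% k)%Z| * g)%g.
  rewrite mulVKg; split=> //.
  apply/quotient_projP; rewrite proj_tX -qS gez0_abs ?modz_ge0 //.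
  by apply/esym/q_mod; rewrite {1}(divz_eq (S g) k) addrK dvdz_mull.
(* S t need not be 1, only congruent to 1 modulo k; this l corrects
   primitive_shift so that the sum of its translates is 1 or -1. *)
have [l lE] : exists l, S t - 1 = l * k by apply/dvdzP/q_mod; rewrite qS.
have S_mull h g : h \in H -> S (h * g)%g = S g.
  by move=> hH; apply: S_proj; exact: proj_mull.
have trV : (t ^- `|k|)%g \in H by rewrite gpredV.
have shift := norm_primitive_shift l k0 kz (fun g => S_mull _ g trV).
pose E := equivariant_cochain (M := M) H.
have period (F : seq G -> M -> M) :
    E F -> iter `|k| (twist t (conj_endo t)) F = F.
  move=> [_ FH]; apply/funext => s; apply/funext => m.
  by rewrite iter_twistE iter_conj_endo FH // gactVK.
have tau_id : conj_endo t idfun = idfun.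
  by apply/funext => m; rewrite /conj_endo gactVK.
have scalE (c : seq G -> int) (s : seq G) (m : M) :
    scal (idfun : M -> M) c s m = m *~ c s.
  by rewrite /scal (zmod_morphismMz (f := fun a : M -> M => a m)).
have E_scal (c : seq G -> int) :
    (forall h s, h \in H -> c (translate h s) = c s) ->
    E (scal (idfun : M -> M) c).
  move=> cH; split=> [s m m'|h hH s m]; rewrite !scalE.
    by rewrite mulrzBl.
  by rewrite cH // (zmod_morphismMz (gactB (M := M) h)).
have prim_l h g0 g1 : h \in H ->
    primitive z (h * g0)%g (h * g1)%g = primitive z g0 g1.
  by move=> hH; apply: z_proj; rewrite /= lquot_mull proj_mull.
have prim_shift_l h g : h \in H ->
    primitive_shift z t l (h * g)%g = primitive_shift z t l g.
  move=> hH; congr (_ - _); apply: z_proj.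
  by rewrite /= quotient_projM (proj_mull g hH) -quotient_projM.
have [y [yB yH] yE] := descent z2 dz (E := E) equivariant_cochainB
  (@equivariant_cochain_twist t) period
  (fun F => equivariant_cochain_acyclic projM) tau_id (K := fun h => h \in H)
  E_scal prim_l prim_shift_l shift zn.
set m := _ * _ in yE.
have mE : m = - Num.sg k.
  by rewrite /m [k * l]mulrC -lE; ring.
have mm : m ^+ n.+1 * m ^+ n.+1 = 1.
  by rewrite -exprMn mE mulrNN -expr2 sqr_sg k0 expr1n.
apply: (transfer_projective nH trH cover
  (phi := fun x => y [::] x *~ m ^+ n.+1)) => //.
  split=> [x x'|h hH x]; first by rewrite yB mulrzBl.
  by rewrite (yH h hH [::]) (zmod_morphismMz (gactB (M := M) h)).
move=> x; rewrite /transfer.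
have /= := congr1 (fun a : M -> M => a x *~ m ^+ n.+1) yE.
rewrite (zmod_morphismMz (f := fun a : M -> M => a x)) // -mulrzA mm mulr1z.
move=> sum_x; rewrite -[RHS]sum_x.
rewrite fct_sumE (zmod_morphism_sum (f := fun v : M => v *~ m ^+ n.+1)); last first.
  by move=> u v; rewrite mulrzBl.
apply: eq_bigr => j _; rewrite iter_conj_endo.
by rewrite (zmod_morphismMz (gactB (M := M) _)).
Qed.
End Projective.
End NilpotentBockstein.

Local Open Scope card_scope.
Local Open Scope classical_set_scope.

Theorem proposition1p4 (Gamma : groupType) (H : groupClosed Gamma)
    (nH : normal_subgroup H) (p : nat) (pr_p : prime p)
    (indexH : [set: coset H] #= `I_p)
    (beta : cohomology Gamma) (beta_bockstein : is_bockstein nH beta)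
    (beta_nilpotent : nilpotent_element beta) :
  Moore_conjecture H.
Proof.
have [k [q [S [z [kp qD q1 [qS S_proj [betaE z2 kz z_proj]]]]]]] :=
  bockstein_cocycle indexH beta_bockstein.
have [n bn] := beta_nilpotent.
have k0 : k != 0 by rewrite -absz_eq0 kp -lt0n prime_gt0.
have /cocycleP[_ dz] := valP z.
(* The exponent n.+1 avoids the case where beta_nilpotent holds with n = 0. *)
have [f _ zn] : is_coboundary (val z ^+ n.+1).
  have /cohomology_classP : cohomology_class (z ^+ n.+1) = cohomology_class 0.
    by rewrite rmorphXn /= -betaE exprS bn mulr0 raddf0.
  by rewrite raddf0 subr0 rmorphXn.
split=> [x xH p0|M projM].
  by apply: (no_torsion_outside k0 qD q1 qS z2 dz kz zn) => //; rewrite kp.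
exact: (projective_of_nilpotent k0 qD q1 qS S_proj z2 dz kz z_proj zn).
Qed.
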